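(* Every treed perinormal domain is a Prüfer domain.
   Context: All rings are commutative unitary integral domains. An overring of a domain $A$ is a ring $B$ between $A$ and the quotient field of $A$. An overring $B$ of $A$ is a going down overring if going down holds for $A\subseteq B$, that is, for each $Q\in\mathrm{Spec}(B)$ the induced map $\mathrm{Spec}(B_Q)\to\mathrm{Spec}(A_{Q\cap A})$ is surjective. $A$ is perinormal if every going down overring of $A$ is flat as an $A$-module. $A$ is treed if any two prime ideals of $A$ that are incomparable under inclusion are comaximal. $A$ is a Prüfer domain if $A_P$ is a valuation domain for every prime ideal $P$ of $A$ (fields count as valuation domains). *)

(* Defs.v *)
From HB Require Import structures.
From mathcomp Require Import all_boot all_algebra.
From mathcomp Require Import ring_quotient fraction boolp.

Set Implicit Arguments.
Unset Strict Implicit.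
Unset Printing Implicit Defensive.

Import GRing.Theory.
Local Open Scope ring_scope.

Local Notation "x %:F" := (@FracField.tofrac _ x).

Section TensorProduct.
Variables (A : comNzRingType) (M N : lmodType A).

(* The list [:: (m1, n1); ...; (mk, nk)] stands for the element
   m1 ⊗ n1 + ... + mk ⊗ nk, so that M ⊗_A N is the quotient of
   [seq (M * N)] by [tensor_eq], with addition induced by [++].  Formal
   differences are not needed, since - (m ⊗ n) = (- m) ⊗ n. *)
Inductive tensor_eq : seq (M * N) -> seq (M * N) -> Prop :=
| tensor_refl s : tensor_eq s s
| tensor_sym s t : tensor_eq s t -> tensor_eq t s
| tensor_trans s t u : tensor_eq s t -> tensor_eq t u -> tensor_eq s u
| tensor_cat s s' t t' :
    tensor_eq s s' -> tensor_eq t t' -> tensor_eq (s ++ t) (s' ++ t')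
| tensor_catC s t : tensor_eq (s ++ t) (t ++ s)
| tensor_0l n : tensor_eq [:: (0, n)] [::]
| tensor_Dl m m' n : tensor_eq [:: (m + m', n)] [:: (m, n); (m', n)]
| tensor_Dr m n n' : tensor_eq [:: (m, n + n')] [:: (m, n); (m, n')]
| tensor_Z a m n : tensor_eq [:: (a *: m, n)] [:: (m, a *: n)].

End TensorProduct.

(* The map f ⊗ id_N on formal sums. *)
Definition tensor_map (A : comNzRingType) (M M' N : lmodType A) (f : M -> M')
    (s : seq (M * N)) : seq (M' * N) :=
  [seq (f x.1, x.2) | x <- s].

Definition flat (A : comNzRingType) (N : lmodType A) : Prop :=
  forall (M M' : lmodType A) (f : {linear M -> M'}), injective f ->
  forall s t : seq (M * N),
    tensor_eq (tensor_map f s) (tensor_map f t) -> tensor_eq s t.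

Section Contraction.
Variables (R S : comNzRingType) (f : {rmorphism R -> S}) (Q : prime_idealr S).

Definition contract_pred : {pred R} := fun x => f x \in Q.

Fact in_contract x : (x \in contract_pred) = (f x \in Q).
Proof. by []. Qed.

Fact contract_idealr_closed : idealr_closed contract_pred.
Proof.
split=> [||a u v]; rewrite !in_contract ?rmorph0 ?rpred0 ?rmorph1 ?idealr1 //.
by move=> Qu Qv; rewrite rmorphD rmorphM rpredD // idealMr.
Qed.

Fact contract_prime : prime_idealr_closed contract_pred.
Proof. by move=> u v; rewrite !in_contract rmorphM prime_idealrM. Qed.

HB.instance Definition _ := isIdealr.Build R contract_pred contract_idealr_closed.
HB.instance Definition _ :=
  isPrimeIdealrClosed.Build R contract_pred contract_prime.

Definition contract : prime_idealr R := contract_pred.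

End Contraction.

Record overring (A : idomainType) := Overring {
  overring_pred : {pred {fraction A}};
  overring_closed : subring_closed overring_pred;
  overring_base : forall a : A, a%:F \in overring_pred
}.

HB.instance Definition _ (A : idomainType) (B : overring A) :=
  GRing.isSubringClosed.Build {fraction A} (overring_pred B) (overring_closed B).

Definition overring_sort (A : idomainType) (B : overring A) : Type :=
  {x : {fraction A} | x \in overring_pred B}.
Coercion overring_sort : overring >-> Sortclass.

Section OverringType.
Variables (A : idomainType) (B : overring A).

HB.instance Definition _ := SubChoice.on B.
HB.instance Definition _ := [SubChoice_isSubComNzRing of B by <:].

Definition overring_in (a : A) : B := Sub (a%:F) (overring_base B a).

Fact overring_in_zmod_morphism : zmod_morphism overring_in.
Proof. by move=> a b; apply: val_inj; rewrite raddfB /= rmorphB. Qed.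
Fact overring_in_monoid_morphism : monoid_morphism overring_in.
Proof.
by split=> [|a b]; apply: val_inj; rewrite /= (rmorph1, rmorphM) //= rmorphM.
Qed.

HB.instance Definition _ :=
  GRing.isZmodMorphism.Build A B overring_in overring_in_zmod_morphism.
HB.instance Definition _ :=
  GRing.isMonoidMorphism.Build A B overring_in overring_in_monoid_morphism.

Definition overring_scale (a : A) (x : B) : B := overring_in a * x.

Fact overring_scaleA a b x :
  overring_scale a (overring_scale b x) = overring_scale (a * b) x.
Proof. by rewrite /overring_scale mulrA rmorphM. Qed.
Fact overring_scale1 : left_id 1 overring_scale.
Proof. by move=> x; rewrite /overring_scale rmorph1 mul1r. Qed.
Fact overring_scaleDr : right_distributive overring_scale +%R.
Proof. by move=> a x y; rewrite /overring_scale mulrDr. Qed.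
Fact overring_scaleDl x : {morph overring_scale^~ x : a b / a + b}.
Proof. by move=> a b; rewrite /overring_scale rmorphD mulrDl. Qed.

HB.instance Definition _ := GRing.Zmodule_isLmodule.Build A B
  overring_scaleA overring_scale1 overring_scaleDr overring_scaleDl.

End OverringType.

Section Inclusion.
Variables (A : idomainType) (B C : overring A).
Hypothesis sBC : {subset overring_pred B <= overring_pred C}.

Definition overring_incl (x : B) : C := Sub (val x) (sBC (valP x)).

Fact overring_incl_zmod_morphism : zmod_morphism overring_incl.
Proof. by move=> x y; apply: val_inj; rewrite raddfB. Qed.
Fact overring_incl_monoid_morphism : monoid_morphism overring_incl.
Proof.
by split=> [|x y]; apply: val_inj; rewrite ?rmorphM ?rmorph1 //= rmorph1.
Qed.

HB.instance Definition _ :=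
  GRing.isZmodMorphism.Build B C overring_incl overring_incl_zmod_morphism.
HB.instance Definition _ :=
  GRing.isMonoidMorphism.Build B C overring_incl overring_incl_monoid_morphism.

End Inclusion.

(* The localization at P of a ring R which sits, via f, between A and its
   fraction field, realized as an overring of A. *)
Section Localization.
Variables (A : idomainType) (R : comNzRingType).
Variable f : {rmorphism R -> {fraction A}}.
Hypothesis f_inj : injective f.
Hypothesis f_base : forall a : A, exists r : R, f r = a%:F.
Variable P : prime_idealr R.

Definition loc_pred : {pred {fraction A}} :=
  fun x => `[< exists r s : R, s \notin P /\ x = f r / f s >].

Fact loc_den_neq0 s : s \notin P -> f s != 0.
Proof.
by apply: contraNneq => fs0; rewrite (_ : s = 0) ?rpred0 //; apply: f_inj;
   rewrite fs0 rmorph0.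
Qed.

Fact loc_den1 : 1 \notin P.
Proof. by rewrite idealr1. Qed.

Fact loc_denM s t : s \notin P -> t \notin P -> s * t \notin P.
Proof. by move=> sP tP; rewrite prime_idealrM negb_or sP. Qed.

Fact loc_subring_closed : subring_closed loc_pred.
Proof.
split=> [|x y|x y]; rewrite /loc_pred !unfold_in.
- by apply/asboolP; exists 1, 1; rewrite loc_den1 rmorph1 divr1.
- move=> /asboolP[r [s [sP ->]]] /asboolP[r' [s' [sP' ->]]]; apply/asboolP.
  exists (r * s' - r' * s), (s * s'); split; first exact: loc_denM.
  rewrite rmorphB !rmorphM -[- (f r' / _)]mulNr addf_div ?loc_den_neq0 //.
  by rewrite mulNr.
- move=> /asboolP[r [s [sP ->]]] /asboolP[r' [s' [sP' ->]]]; apply/asboolP.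
  exists (r * r'), (s * s'); split; first exact: loc_denM.
  by rewrite !rmorphM mulf_div.
Qed.

Fact loc_base a : a%:F \in loc_pred.
Proof.
rewrite /loc_pred !unfold_in; apply/asboolP.
by have [r <-] := f_base a; exists r, 1; rewrite loc_den1 rmorph1 divr1.
Qed.

Definition loc : overring A := Overring loc_subring_closed loc_base.

End Localization.

Section LocalizationAt.
Variable A : idomainType.

Fact tofrac_inj : injective (@FracField.tofrac A).
Proof. by move=> a b /eqP; rewrite tofrac_eq => /eqP. Qed.

Fact tofrac_base (a : A) : exists r : A, r%:F = a%:F.
Proof. by exists a. Qed.

Fact val_base (B : overring A) (a : A) : exists r : B, val r = a%:F.
Proof. by exists (overring_in B a). Qed.

Definition loc_dom (P : prime_idealr A) : overring A :=
  loc tofrac_inj tofrac_base P.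

Definition loc_over (B : overring A) (Q : prime_idealr B) : overring A :=
  loc (f := val) val_inj (@val_base B) Q.

Fact loc_contract_sub (B : overring A) (Q : prime_idealr B) :
  {subset overring_pred (loc_dom (contract (overring_in B) Q))
     <= overring_pred (loc_over Q)}.
Proof.
move=> x; rewrite /= /loc_pred !unfold_in => /asboolP[r [s [sQ ->]]].
by apply/asboolP; exists (overring_in B r), (overring_in B s).
Qed.

End LocalizationAt.

Section Notions.
Variable A : idomainType.

(* A prime of A_(Q ∩ A) is contracted from B_Q along A_(Q ∩ A) ⊆ B_Q, both
   rings being realized inside the fraction field of A. *)
Definition going_down (B : overring A) : Prop :=
  forall (Q : prime_idealr B)
         (P : prime_idealr (loc_dom (contract (overring_in B) Q))),
  exists Q' : prime_idealr (loc_over Q),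
    contract (overring_incl (@loc_contract_sub A B Q)) Q' =i P.

Definition perinormal : Prop :=
  forall B : overring A, going_down B -> flat B.

Definition comaximal (I J : {pred A}) : Prop :=
  exists x y : A, [/\ x \in I, y \in J & x + y = 1].

Definition treed : Prop :=
  forall P Q : prime_idealr A,
    ~ {subset P <= Q} -> ~ {subset Q <= P} -> comaximal P Q.

(* The fraction field of an overring of A is that of A. *)
Definition valuation_domain (V : overring A) : Prop :=
  forall x : {fraction A}, x \in overring_pred V \/ x^-1 \in overring_pred V.

Definition prufer : Prop :=
  forall P : prime_idealr A, valuation_domain (loc_dom P).

End Notions.

(* Main.v *)
From HB Require Import structures.
Require Import Defs.
From mathcomp Require Import all_boot all_algebra.
From mathcomp Require Import ring_quotient fraction generic_quotient boolp.
From mathcomp Require Import classical_sets ring.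

(* Fix a prime P of the treed domain A.  The primes p <= P form a chain, so the
   pA_p with p <= P generate an additive group I which is an ideal of the ring
   A_P + I and does not contain 1.  By Chevalley's extension theorem there is a
   valuation overring V of A_P with a proper ideal J containing I.  Since V
   contains all a / s with a in p, s in A \ p and p <= P, every prime p <= P
   below a prime Q of V is contracted from V_Q, so V is a going down overring.
   By perinormality V is flat, and flatness provides for each x in V some d in
   A \ P with d x in A.  Hence V = A_P is a valuation domain. *)

Set Implicit Arguments.
Unset Strict Implicit.
Unset Printing Implicit Defensive.

Import GRing.Theory.
Local Open Scope ring_scope.

(** * Chevalley's extension theorem in a field *)

Section Chevalley.
Variable K : fieldType.
Implicit Types (R J : K -> Prop) (x : K) (p q : {poly K}).

Record subring_ideal R J : Prop := SubringIdeal {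
  subring1 : R 1;
  subringB : forall x y, R x -> R y -> R (x - y);
  subringM : forall x y, R x -> R y -> R (x * y);
  ideal_sub : forall x, J x -> R x;
  ideal0 : J 0;
  idealD : forall x y, J x -> J y -> J (x + y);
  idealM : forall x y, R x -> J y -> J (x * y);
  ideal1 : ~ J 1 }.

Section Pair.
Variables R J : K -> Prop.
Hypothesis RJ : subring_ideal R J.

Lemma subring0 : R 0.
Proof. exact/(ideal_sub RJ)/(ideal0 RJ). Qed.

Lemma subringN x : R x -> R (- x).
Proof. by move=> Rx; rewrite -sub0r; exact: (subringB RJ subring0 Rx). Qed.

Lemma subringD x y : R x -> R y -> R (x + y).
Proof. by move=> Rx Ry; rewrite -[y]opprK; apply: (subringB RJ Rx (subringN Ry)). Qed.

Definition coefs_in (S : K -> Prop) p := forall i, S p`_i.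

Lemma coefs_inMJ p q : coefs_in R p -> coefs_in J q -> coefs_in J (p * q).
Proof.
move=> Rp Jq i; rewrite coefM.
elim/big_ind: _ => [||j _]; first exact: (ideal0 RJ).
  exact: (idealD RJ).
exact: (idealM RJ).
Qed.

Lemma coefs_inMR p q : coefs_in R p -> coefs_in R q -> coefs_in R (p * q).
Proof.
move=> Rp Rq i; rewrite coefM.
by elim/big_ind: _ => [||j _]; [exact: subring0|exact: subringD|exact: (subringM RJ)].
Qed.

(** For [S = R] this is the ring [R[x]]; for [S = J] it is the ideal of [R[x]] generated by [J]. *)
Definition adjoin (S : K -> Prop) x y := exists2 p, coefs_in S p & y = p.[x].

Lemma adjoin_sub (S : K -> Prop) x y : S 0 -> S y -> adjoin S x y.
Proof.
by move=> S0 Sy; exists y%:P => [i|]; rewrite ?hornerC ?coefC //; case: eqP.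
Qed.

Lemma subring_ideal_adjoin x : ~ adjoin J x 1 ->
  subring_ideal (adjoin R x) (adjoin J x).
Proof.
move=> J1; split=> //.
- by apply: adjoin_sub; [exact: subring0|exact: (subring1 RJ)].
- move=> _ _ [p Rp ->] [q Rq ->]; exists (p - q); last by rewrite !hornerE.
  by move=> i; rewrite coefB; apply: (subringB RJ).
- move=> _ _ [p Rp ->] [q Rq ->]; exists (p * q); last by rewrite !hornerE.
  exact: coefs_inMR.
- by move=> _ [p Jp ->]; exists p => // i; apply: (ideal_sub RJ).
- by apply: adjoin_sub; exact: (ideal0 RJ).
- move=> _ _ [p Jp ->] [q Jq ->]; exists (p + q); last by rewrite !hornerE.
  by move=> i; rewrite coefD; apply: (idealD RJ).
- move=> _ _ [p Rp ->] [q Jq ->]; exists (p * q); last by rewrite !hornerE.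
  exact: coefs_inMJ.
Qed.

Lemma adjoin_id x : adjoin R x x.
Proof.
exists 'X; last by rewrite hornerX.
by move=> i; rewrite coefX; case: eqP => _; [exact: (subring1 RJ)|exact: subring0].
Qed.

(* If [deg q <= deg p], the relation [(1 - q_0) x^k = \sum_(i > 0) q_i x^(k-i)]
   lowers the degree of [p]. *)
Lemma adjoin_inv_aux n x p q : (size p + size q <= n)%N ->
  coefs_in J p -> coefs_in J q -> p.[x] = 1 -> q.[x^-1] = 1 -> False.
Proof.
elim: n x p q => [|n IHn] x p q.
  rewrite leqn0 addn_eq0 size_poly_eq0 => /andP[/eqP-> _] _ _.
  by rewrite horner0 => /eqP; rewrite eq_sym oner_eq0.
(* Exchanging [x] with [x^-1] swaps the roles of [p] and [q]. *)
wlog le_qp : x p q / (size q <= size p)%N.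
  move=> IH; case: (leqP (size q) (size p)) => [/IH|/ltnW/IH] h; first exact: h.
  move=> spq Jp Jq px qx; apply: (h x^-1) => //; rewrite ?invrK //.
  by rewrite addnC.
move=> spq Jp Jq px qx.
have [sq1|sq1] := leqP (size q) 1.
  apply: (ideal1 RJ); rewrite -qx (size1_polyC sq1) hornerC; exact: Jq.
have [x0|x0] := eqVneq x 0.
  by apply: (ideal1 RJ); rewrite -px x0 horner_coef0; exact: Jp.
case Dm: (size q) sq1 le_qp => [//|m] m_gt0 le_mp.
case Dk: (size p) le_mp => [//|k] le_mk.
(* [r] is [q] reversed, without its constant term: [r.[x]] equals [x^m (q.[x^-1] - q_0)], where [m]
   is the degree of [q]. *)
pose r := \poly_(i < m) q`_(m - i).
have rx : r.[x] = (1 - q`_0) * x ^+ m.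
  rewrite horner_poly -qx (horner_coef q) Dm big_ord_recl /= expr0 mulr1.
  rewrite [_ + _ - _]addrAC subrr add0r big_distrl /= (reindex_inj rev_ord_inj) /=.
  apply: eq_bigr => i _; rewrite subKn // -mulrA; congr (_ * _).
  have -> : x ^+ m = x ^+ (m - i.+1) * x ^+ i.+1 by rewrite -exprD subnK.
  by rewrite exprVn mulrCA mulVf ?mulr1 ?expf_neq0.
(* Multiply [p.[x] = 1] by [1 - q_0], add [q_0], and replace the top term [(1 - q_0) p_k x^k] by
   [p_k x^(k-m) r.[x]], whose degree is below [k]. *)
pose p' := (1 - q`_0)%:P * (\poly_(i < k) p`_i) + (q`_0)%:P
  + (p`_k)%:P * 'X^(k - m) * r.
have J1 : J q`_0 by exact: Jq.
have R1 : R (1 - q`_0).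
  by apply: (subringB RJ); [exact: (subring1 RJ)|exact: (ideal_sub RJ)].
apply: (IHn x p' q); rewrite ?Dm //.
- have: (size p' <= k)%N.
    rewrite (leq_trans (size_polyD _ _)) // geq_max; apply/andP; split.
      rewrite (leq_trans (size_polyD _ _)) // geq_max; apply/andP; split.
        by rewrite mul_polyC (leq_trans (size_scale_leq _ _)) ?size_poly //.
      exact: leq_trans (size_polyC_leq1 _) (leq_trans m_gt0 le_mk).
    rewrite -mulrA mul_polyC (leq_trans (size_scale_leq _ _)) //.
    rewrite (leq_trans (size_polyMleq _ _)) // size_polyXn addSn /=.
    by rewrite -leq_subRL ?leq_subr // subKn // size_poly.
  move=> sp'; rewrite -ltnS (leq_trans _ spq) // Dk Dm addSn ltnS.
  by rewrite leq_add2r.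
- move=> i; rewrite !coefD; apply: (idealD RJ); first apply: (idealD RJ).
  + rewrite coefCM coef_poly; apply: (idealM RJ) => //.
    by case: ifP => _; [exact: Jp|exact: (ideal0 RJ)].
  + by rewrite coefC; case: eqP => // _; exact: (ideal0 RJ).
  + rewrite -mulrA mulrC -mulrA; apply: coefs_inMJ.
    * move=> j; rewrite coefXn; case: eqP => _; last exact: subring0.
      exact: (subring1 RJ).
    * move=> j; rewrite mulrC coefCM; apply: (idealM RJ); first exact/(ideal_sub RJ).
      by rewrite coef_poly; case: ifP => _; [exact: Jq|exact: (ideal0 RJ)].
- have px' : (\poly_(i < k) p`_i).[x] = 1 - p`_k * x ^+ k.
    rewrite -px (horner_coef p) Dk big_ord_recr /= horner_poly.
    by rewrite addrK.
  rewrite /p' !hornerE px' rx.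
  have -> : x ^+ k = x ^+ (k - m) * x ^+ m by rewrite -exprD subnK.
  ring.
Qed.

Lemma adjoin_inv x : adjoin J x 1 -> adjoin J x^-1 1 -> False.
Proof.
by move=> [p Jp px] [q Jq qx]; apply: (adjoin_inv_aux (leqnn _) Jp Jq (esym px)).
Qed.

(** [J] cannot generate the unit ideal both in [R[x]] and in [R[x^-1]]. Where it stays proper,
    maximality puts the adjoined element in [R]. *)
Lemma valuation_of_maximal :
  (forall R' J', subring_ideal R' J' -> (forall x, R x -> R' x) ->
    (forall x, J x -> J' x) -> forall x, R' x -> R x) ->
  forall x, R x \/ R x^-1.
Proof.
move=> maxR x; have step y : ~ adjoin J y 1 -> R y.
  move=> /subring_ideal_adjoin RJy; apply: (maxR _ _ RJy) (adjoin_id y) => z.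
    exact/adjoin_sub/subring0.
  exact/adjoin_sub/(ideal0 RJ).
case: (pselect (adjoin J x 1)) => [Jx|/step]; last by left.
by right; apply: step => /(adjoin_inv Jx).
Qed.

End Pair.

(** Zorn's lemma for the pairs above [(R0, J0)], ordered by inclusion in both components. *)
Lemma exists_valuation (R0 J0 : K -> Prop) : subring_ideal R0 J0 ->
  exists R J : K -> Prop, [/\ subring_ideal R J, forall x, R0 x -> R x,
    forall x, J0 x -> J x & forall x, R x \/ R x^-1].
Proof.
move=> RJ0.
pose above (t : (K -> Prop) * (K -> Prop)) := [/\ subring_ideal t.1 t.2,
  forall x, R0 x -> t.1 x & forall x, J0 x -> t.2 x].
pose T := {t | above t}.
pose t0 : T := exist above (R0, J0) (And3 RJ0 (fun _ => id) (fun _ => id)).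
pose le (s t : T) := `[< (forall x, (sval s).1 x -> (sval t).1 x) /\
  (forall x, (sval s).2 x -> (sval t).2 x) >].
have [||C totC|[[R J] [/= RJ R0R J0J]] maxRJ] := ZL_preorder t0 (R := le).
- by move=> t; apply/asboolP.
- move=> r s t /asboolP[rs1 rs2] /asboolP[st1 st2]; apply/asboolP.
  by split=> x /[dup]; [move=> _ /rs1/st1|move=> _ /rs2/st2].
(* The empty chain is bounded by [(R0, J0)], a nonempty one by its union. *)
- have [[c Cc]|C0] := pselect (exists c, C c); last first.
    by exists t0 => s Cs; case: C0; exists s.
  pose R x := exists2 s, C s & (sval s).1 x.
  pose J x := exists2 s, C s & (sval s).2 x.
  (* Two elements of the union lie in one member of the chain, from which the closure properties are
     inherited. *)
  have join s t : C s -> C t -> exists r, [/\ C r, le s r & le t r].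
    move=> Cs Ct; have [|] := totC _ _ Cs Ct => h; [exists t|exists s];
    by split=> //; apply/asboolP.
  have RJ : subring_ideal R J.
    have ax (s : T) : subring_ideal (sval s).1 (sval s).2 by case: (svalP s).
    split.
    + by exists c => //; apply: (subring1 (ax c)).
    + move=> x y [s Cs sx] [t Ct ty].
      have [r [Cr /asboolP[sr _] /asboolP[tr _]]] := join _ _ Cs Ct.
      by exists r => //; apply: (subringB (ax r)); [apply: sr|apply: tr].
    + move=> x y [s Cs sx] [t Ct ty].
      have [r [Cr /asboolP[sr _] /asboolP[tr _]]] := join _ _ Cs Ct.
      by exists r => //; apply: (subringM (ax r)); [apply: sr|apply: tr].
    + by move=> x [s Cs sx]; exists s => //; apply: (ideal_sub (ax s)).
    + by exists c => //; apply: (ideal0 (ax c)).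
    + move=> x y [s Cs sx] [t Ct ty].
      have [r [Cr /asboolP[_ sr] /asboolP[_ tr]]] := join _ _ Cs Ct.
      by exists r => //; apply: (idealD (ax r)); [apply: sr|apply: tr].
    + move=> x y [s Cs sx] [t Ct ty].
      have [r [Cr /asboolP[sr _] /asboolP[_ tr]]] := join _ _ Cs Ct.
      by exists r => //; apply: (idealM (ax r)); [apply: sr|apply: tr].
    + by case=> s Cs; exact: (ideal1 (ax s)).
  have [_ R0c J0c] := svalP c.
  have RJc : above (R, J).
    by split=> // x hx; exists c => //; [apply: R0c|apply: J0c].
  exists (exist above _ RJc) => s Cs; apply/asboolP.
  by split=> x sx; exists s.
- exists R, J; split=> //; apply: (valuation_of_maximal RJ) => R' J' RJ' RR' JJ'.
  have RJt : above (R', J').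
    by split=> // x; [move/R0R/RR'|move/J0J/JJ'].
  have /asboolP[] // : le (exist above _ RJt) (exist above (R, J) (And3 RJ R0R J0J)).
  by apply: maxRJ; apply/asboolP.
Qed.

End Chevalley.

(** * Sums over chains of primes contained in [P] *)

Section ChainSum.
Variable A : idomainType.
Local Notation K := {fraction A}.
Local Notation "x %:F" := (@FracField.tofrac A x).
Implicit Types p q r t : prime_idealr A.

Lemma notin_prime_neq0 p s : s \notin p -> s != 0.
Proof. by apply: contraNneq => ->; rewrite idealr0. Qed.

Lemma loc_domP p (x : K) :
  reflect (exists a s, s \notin p /\ x = a%:F / s%:F)
    (x \in overring_pred (loc_dom p)).
Proof. exact: asboolP. Qed.

Lemma loc_dom_anti p q (x : K) : {subset q <= p} ->
  x \in overring_pred (loc_dom p) -> x \in overring_pred (loc_dom q).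
Proof.
move=> qp /loc_domP[a [s [sp ->]]]; apply/loc_domP; exists a, s; split=> //.
exact: contraNN (qp s) sp.
Qed.

(** The maximal ideal [pA_p] of [A_p], inside the fraction field. *)
Definition loc_max p (x : K) :=
  exists a s, [/\ a \in p, s \notin p & x = a%:F / s%:F].

Lemma loc_max_sub p x : loc_max p x -> x \in overring_pred (loc_dom p).
Proof. by move=> [a [s [_ sp ->]]]; apply/loc_domP; exists a, s. Qed.

Lemma loc_max0 p : loc_max p 0.
Proof. by exists 0, 1; rewrite idealr0 idealr1 tofrac0 mul0r. Qed.

Lemma loc_maxD p x y : loc_max p x -> loc_max p y -> loc_max p (x + y).
Proof.
move=> [a [s [ap sp ->]]] [b [t [bp tp ->]]].
exists (a * t + b * s), (s * t); split.
- by rewrite rpredD // mulrC idealMr.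
- by rewrite prime_idealrM negb_or sp.
- rewrite tofracD !tofracM addf_div // tofrac_eq0; first exact: notin_prime_neq0 sp.
  exact: notin_prime_neq0 tp.
Qed.

Lemma loc_maxM p x y :
  x \in overring_pred (loc_dom p) -> loc_max p y -> loc_max p (x * y).
Proof.
move=> /loc_domP[a [s [sp ->]]] [b [t [bp tp ->]]].
exists (a * b), (s * t); split; first exact: idealMr.
- by rewrite prime_idealrM negb_or sp.
- by rewrite !tofracM mulf_div.
Qed.

Lemma loc_max1 p : ~ loc_max p 1.
Proof.
move=> [a [s [ap sp /eqP]]].
have s0 := notin_prime_neq0 sp.
rewrite eq_sym -subr_eq0 -[1](divff (x := s%:F)) ?tofrac_eq0 //.
rewrite -mulrBl mulf_eq0 invr_eq0 tofrac_eq0 (negPf s0) orbF.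
by rewrite -tofracB tofrac_eq0 subr_eq0 => /eqP Eas; rewrite -Eas ap in sp.
Qed.

(** From [a / s = b / t] one gets [b s = a t] in [q]; as [s] is outside [q], [b] is in [q], hence in
    [p]. *)
Lemma loc_max_descent p q x : {subset q <= p} -> loc_max q x ->
  x \in overring_pred (loc_dom p) -> loc_max p x.
Proof.
move=> qp [a [s [aq sq ->]]] /loc_domP[b [t [tp E]]]; exists b, t; split=> //.
have s0 := notin_prime_neq0 sq; have t0 := notin_prime_neq0 tp.
have /eqP : a%:F * t%:F = b%:F * s%:F.
  by apply/eqP; rewrite -eqr_div ?tofrac_eq0 //; apply/eqP.
rewrite -!tofracM tofrac_eq => /eqP Eab; apply: qp.
have : b * s \in q by rewrite -Eab mulrC idealMr.
by rewrite prime_idealrM (negPf sq) orbF.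
Qed.

Variable P : prime_idealr A.

(* The sums [y_1 + ... + y_n] with [y_i] in [p_i A_(p_i)] for an increasing
   chain of primes [q = p_1 <= ... <= p_n <= P]. *)
Inductive chain_sum : prime_idealr A -> K -> Prop :=
| chain_sum1 q y : {subset q <= P} -> loc_max q y -> chain_sum q y
| chain_sumS q r y z : {subset q <= r} -> loc_max q y -> chain_sum r z ->
    chain_sum q (y + z).

Lemma chain_sum_prime q z : chain_sum q z -> {subset q <= P}.
Proof. by elim=> // {}q r _ _ qr _ _ rP x /qr/rP. Qed.

(** Localizations grow as the prime shrinks, so all terms lie in the ring of the smallest prime. *)
Lemma chain_sum_loc q z : chain_sum q z -> z \in overring_pred (loc_dom q).
Proof.
elim=> {q z} [q y _ /loc_max_sub //|q r y z qr /loc_max_sub yq _ zr].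
by rewrite rpredD // (loc_dom_anti qr).
Qed.

(** The term 0 of [tA_t] can be prepended, so two sums can be given a common smallest prime. *)
Lemma chain_sum_anti q t z : {subset t <= q} -> chain_sum q z -> chain_sum t z.
Proof. by move=> tq qz; rewrite -[z]add0r; apply: chain_sumS tq (loc_max0 t) qz. Qed.

(* The smallest term of a sum equal to 1 lies in the local ring of the next
   prime, so it can be absorbed into the next term. *)
Lemma chain_sum_neq1 q z : chain_sum q z -> z <> 1.
Proof.
(* The extra term [w] carries what has been absorbed so far through the induction. *)
suff H : chain_sum q z -> forall w, loc_max q w -> w + z <> 1.
  by move=> qz; rewrite -[z]add0r; exact: (H qz 0 (loc_max0 q)).
elim=> {q z} [q y _ qy|q r y z qr qy rz IHz] w qw.
  by have := loc_maxD qw qy => /[swap] ->; exact: loc_max1.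
rewrite addrA => E; apply: (IHz _ _ E); apply: (loc_max_descent qr).
  exact: loc_maxD.
(* [w + y = 1 - z], and [z] lies in [A_r]. *)
rewrite -[w + y](addrK z) E rpredB ?rpred1 //; exact: chain_sum_loc rz.
Qed.

Hypothesis trA : treed A.

(** Incomparable primes would be comaximal, and [P] would contain 1. *)
Lemma treed_chain q r : {subset q <= P} -> {subset r <= P} ->
  {subset q <= r} \/ {subset r <= q}.
Proof.
move=> qP rP; have [|nqr] := pselect {subset q <= r}; first by left.
have [|nrq] := pselect {subset r <= q}; first by right.
have [x [y [xq yr E]]] := trA nqr nrq.
by have := idealr1 P; rewrite -E rpredD ?(qP x) ?(rP y).
Qed.

(** Insertion into a sorted list: the term [y] moves past the primes contained in [r]. The bound [t]
    avoids naming the smaller of [q] and [r]. *)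
Lemma chain_sum_insert r q y z t : {subset r <= P} -> loc_max r y ->
  chain_sum q z -> {subset t <= r} -> {subset t <= q} -> chain_sum t (y + z).
Proof.
move=> rP ry qz; have sum1 := chain_sum1 rP ry.
elim: qz t => {q z} [q z qP qz|q q' z z' qq' qz q'z' IHz] t tr tq.
  have [qr|rq] := treed_chain qP rP.
    by rewrite addrC; apply: (chain_sum_anti tq); apply: chain_sumS qr qz sum1.
  by apply: (chain_sum_anti tr); apply: chain_sumS rq ry (chain_sum1 qP qz).
have q'P := chain_sum_prime q'z'.
have [qr|rq] := treed_chain (fun x h => q'P x (qq' x h)) rP.
  rewrite addrCA; apply: (chain_sum_anti tq).
  by apply: chain_sumS qz (IHz q qr qq'); move=> x.
apply: (chain_sum_anti tr); apply: (chain_sumS rq ry).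
exact: chain_sumS qq' qz q'z'.
Qed.

Lemma chain_sumD q r t y z : chain_sum r y -> chain_sum q z ->
  {subset t <= r} -> {subset t <= q} -> chain_sum t (y + z).
Proof.
move=> ry qz; elim: ry t => {r y} [r y rP ry|r r' y y' rr' ry r'y' IHy] t tr tq.
  exact: (chain_sum_insert rP ry qz).
rewrite -addrA; apply: (@chain_sum_insert r t y) => //.
  by move=> x /rr'/(chain_sum_prime r'y').
by apply: IHy => // x /tr/rr'.
Qed.

Lemma chain_sumZ q x z : x \in overring_pred (loc_dom P) -> chain_sum q z ->
  chain_sum q (x * z).
Proof.
move=> xP qz; elim: qz => {q z} [q z qP qz|q r y z qr qy rz IHz].
  by apply: chain_sum1 => //; apply: loc_maxM => //; apply: loc_dom_anti xP.
rewrite mulrDr; apply: (chain_sumS qr) => //.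
by apply: loc_maxM => //; apply: loc_dom_anti xP => u /qr/(chain_sum_prime rz).
Qed.

(** For [q <= r] the ring [A_r] lies in [A_q], so the product of an element of [qA_q] with one of
    [rA_r] is in [qA_q]. Distributivity does the rest. *)
Lemma chain_sumM1 r q y z t : {subset r <= P} -> loc_max r y ->
  chain_sum q z -> {subset t <= r} -> {subset t <= q} -> chain_sum t (y * z).
Proof.
move=> rP ry qz; elim: qz t => {q z} [q z qP qz|q q' z z' qq' qz q'z' IHz] t tr tq.
  have [qr|rq] := treed_chain qP rP.
    apply: (chain_sum_anti tq); apply: chain_sum1 => //; apply: loc_maxM => //.
    exact: loc_dom_anti qr (loc_max_sub ry).
  apply: (chain_sum_anti tr); apply: chain_sum1 => //.
  by rewrite mulrC; apply: loc_maxM => //; apply: loc_dom_anti rq (loc_max_sub qz).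
have qP : {subset q <= P} by move=> x /qq'/(chain_sum_prime q'z').
rewrite mulrDr; apply: (@chain_sumD t t) => //.
  have [qr|rq] := treed_chain qP rP.
    apply: (chain_sum_anti tq); apply: chain_sum1 => //; apply: loc_maxM => //.
    exact: loc_dom_anti qr (loc_max_sub ry).
  apply: (chain_sum_anti tr); apply: chain_sum1 => //.
  by rewrite mulrC; apply: loc_maxM => //; apply: loc_dom_anti rq (loc_max_sub qz).
by apply: IHz => // x /tq/qq'.
Qed.

Lemma chain_sumM q r y z : chain_sum r y -> chain_sum q z ->
  exists t, chain_sum t (y * z).
Proof.
move=> ry qz; suff H t : {subset t <= r} -> {subset t <= q} -> chain_sum t (y * z).
  have [qr|rq] := treed_chain (chain_sum_prime qz) (chain_sum_prime ry).
    by exists q; apply: H.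
  by exists r; apply: H.
elim: ry t => {r y} [r y rP ry|r r' y y' rr' ry r'y' IHy] t tr tq.
  exact: (chain_sumM1 rP ry qz).
rewrite mulrDl; apply: (@chain_sumD t t) => //.
  by apply: (chain_sumM1 _ ry qz) => // x /rr'/(chain_sum_prime r'y').
by apply: IHy => // x /tr/rr'.
Qed.

(** In a treed domain this is [I], the sum of all [pA_p] with [p <= P], and [chain_ring] is
    [A_P + I]. *)
Definition chain_ideal (z : K) := exists q, chain_sum q z.
Definition chain_ring (z : K) :=
  exists2 x, x \in overring_pred (loc_dom P) & chain_ideal (z - x).

Lemma chain_idealD y z : chain_ideal y -> chain_ideal z -> chain_ideal (y + z).
Proof.
move=> [r ry] [q qz].
have [qr|rq] := treed_chain (chain_sum_prime qz) (chain_sum_prime ry).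
  by exists q; apply: chain_sumD ry qz _ _.
by exists r; apply: chain_sumD ry qz _ _.
Qed.

Lemma chain_idealZ x z : x \in overring_pred (loc_dom P) ->
  chain_ideal z -> chain_ideal (x * z).
Proof. by move=> xP [q qz]; exists q; apply: chain_sumZ. Qed.

Lemma chain_ideal0 : chain_ideal 0.
Proof. by exists P; apply: chain_sum1 (loc_max0 P). Qed.

(** [I] is stable under products and under scaling by [A_P], which makes [A_P + I] a ring and [I] an
    ideal of it. *)
Lemma chain_subring_ideal : subring_ideal chain_ring chain_ideal.
Proof.
have idN z : chain_ideal z -> chain_ideal (- z).
  by rewrite -mulN1r; apply: chain_idealZ; rewrite rpredN1.
split.
- by exists 1; rewrite ?rpred1 // subrr; exact: chain_ideal0.
- move=> x y [a aP ax] [b bP bY]; exists (a - b); first by rewrite rpredB.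
  rewrite (_ : _ - _ = (x - a) + - (y - b)); last by ring.
  exact/chain_idealD/idN.
- move=> x y [a aP ax] [b bP bY]; exists (a * b); first by rewrite rpredM.
  rewrite (_ : _ - _ = ((x - a) * (y - b) + a * (y - b)) + b * (x - a)); last by ring.
  apply: chain_idealD; last exact: chain_idealZ.
  apply: chain_idealD; last exact: chain_idealZ.
  by case: ax bY => [r rx] [q qy]; apply: chain_sumM rx qy.
- by move=> x Ix; exists 0; rewrite ?rpred0 ?subr0.
- exact: chain_ideal0.
- exact: chain_idealD.
- move=> x y [a aP [r ax]] [q qy]; rewrite -[x](subrK a) mulrDl.
  apply: chain_idealD; first exact: chain_sumM ax qy.
  by apply: chain_idealZ => //; exists q.
- by case=> q /chain_sum_neq1; apply.
Qed.

Lemma treed_valuation : exists V J : K -> Prop,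
  [/\ subring_ideal V J, forall x, x \in overring_pred (loc_dom P) -> V x,
      forall q x, {subset q <= P} -> loc_max q x -> J x
    & forall x, V x \/ V x^-1].
Proof.
have [V [J [VJ RV IJ val]]] := exists_valuation chain_subring_ideal.
exists V, J; split=> // [x xP|q x qP qx].
  by apply: RV; exists x => //; rewrite subrr; exact: chain_ideal0.
by apply: IJ; exists q; apply: chain_sum1.
Qed.

End ChainSum.

(** * The ideal [(b, c)] as a module *)

Section PairIdeal.
Variables (A : idomainType) (b c : A).

Definition pair_ideal : {pred A^o} := fun m => `[< exists u v, m = u * b + v * c >].

Lemma pair_idealP m : reflect (exists u v, m = u * b + v * c) (m \in pair_ideal).
Proof. exact: asboolP. Qed.

Fact pair_ideal_submod : submod_closed pair_ideal.
Proof.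
split=> [|a _ _ /pair_idealP[u [v ->]] /pair_idealP[u' [v' ->]]]; apply/pair_idealP.
  by exists 0, 0; rewrite !mul0r addr0.
by exists (a * u + u'), (a * v + v'); rewrite /GRing.scale /=; ring.
Qed.

HB.instance Definition _ :=
  GRing.isSubmodClosed.Build A A^o pair_ideal pair_ideal_submod.

Definition pair_module : Type := {m : A^o | m \in pair_ideal}.
HB.instance Definition _ := SubChoice.on pair_module.
HB.instance Definition _ := [SubChoice_isSubLmodule of pair_module by <:].

(** The injection on which flatness is tested. *)
Definition pair_val (m : pair_module) : A^o := val m.

Fact pair_val_linear : linear pair_val.
Proof. by move=> a x y; rewrite /pair_val linearP. Qed.

HB.instance Definition _ :=
  GRing.isLinear.Build A pair_module A^o _ pair_val pair_val_linear.

Lemma pair_l_subproof : (b : A^o) \in pair_ideal.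
Proof. by apply/pair_idealP; exists 1, 0; rewrite mul1r mul0r addr0. Qed.

Lemma pair_r_subproof : (c : A^o) \in pair_ideal.
Proof. by apply/pair_idealP; exists 0, 1; rewrite mul1r mul0r add0r. Qed.

Definition pair_l : pair_module := Sub (b : A^o) pair_l_subproof.
Definition pair_r : pair_module := Sub (c : A^o) pair_r_subproof.

Lemma pair_coef_subproof (m : pair_module) :
  exists u, exists v, val m = u * b + v * c.
Proof. exact/pair_idealP/(valP m). Qed.

(** A chosen [u] with [m = u b + v c]. It need be neither unique nor linear in [m], whence the later
    computation modulo an ideal. *)
Definition pair_coef (m : pair_module) : A := sval (cid (pair_coef_subproof m)).

Lemma pair_coefP m : exists v, val m = pair_coef m * b + v * c.
Proof. exact: (svalP (cid (pair_coef_subproof m))). Qed.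

End PairIdeal.

Lemma fraction_divP (A : idomainType) (x : {fraction A}) : exists b c : A,
  c != 0 /\ x = FracField.tofrac b / FracField.tofrac c.
Proof.
elim/quotW: x => r; have r0 := denom_ratioP r.
exists \n_r, \d_r; split=> //; apply: (canRL (mulfK _)); first by rewrite tofrac_eq0.
rewrite -[LHS]/(FracField.mul _ _) !piE; apply/eqmodP.
rewrite /= FracField.equivfE /FracField.mulf !numden_Ratio ?mulf_neq0 ?oner_neq0 //.
by rewrite !mulr1 mulrC.
Qed.

(** * Denominators in a flat overring *)

Section FlatOverring.
Variables (A : idomainType) (B : overring A) (J : {pred B}).
Hypothesis idJ : idealr_closed J.

(* For [x = b / c] in [B], flatness gives [c ⊗ x = b ⊗ 1] in [(b, c) ⊗ B].  If
   every [d] with [d x \in A] were in [J], then [(u b + v c) ⊗ y |-> u y] would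
   be well defined modulo [J] and send the two sides to 0 and 1. *)
Lemma flat_overring_denominator (x : B) : flat B ->
  exists a d : A, overring_in B d \notin J /\ overring_in B d * x = overring_in B a.
Proof.
move=> flB; have [J0 J1 JD] := idJ; apply: contrapT => noden.
have JM u y : y \in J -> u * y \in J by move=> yJ; rewrite -[_ * _]addr0 JD.
have Ja y z : y \in J -> z \in J -> y + z \in J by rewrite -{2}[y]mul1r; exact: JD.
have JN y : y \in J -> - y \in J by rewrite -mulN1r; exact: JM.
have [b [c [c0 xbc]]] := fraction_divP (val x).
have cF0 : FracField.tofrac c != 0 by rewrite tofrac_eq0.
(* [d b = e c] says [d x = e], so [d] is a denominator of [x]. *)
have denJ d e : d * b = e * c -> overring_in B d \in J.
  move=> dbec; apply: contra_notT noden => dJ; exists e, d; split=> //.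
  by apply: val_inj; rewrite /= xbc mulrA -tofracM dbec tofracM mulfK.
(* Two first coefficients of the same element differ by such a [d]. *)
have coefJ (m : pair_module b c) u v : val m = u * b + v * c ->
    overring_in B (pair_coef m - u) \in J.
  move=> mE; have [w] := pair_coefP m; rewrite mE => E.
  apply: (denJ _ (v - w)); apply/eqP; rewrite -subr_eq0; apply/eqP.
  transitivity ((pair_coef m * b + w * c) - (u * b + v * c)); first by ring.
  by rewrite -E subrr.
pose phi (s : seq (pair_module b c * B)) : B :=
  \sum_(y <- s) overring_in B (pair_coef y.1) * y.2.
have phiJ s t : tensor_eq s t -> phi s - phi t \in J.
  rewrite /phi; elim=> {s t}.
  - by move=> s; rewrite subrr.
  - by move=> s t _ /JN; rewrite opprB.
  - by move=> s t u _ st _ tu; rewrite -(subrKA (phi t)) Ja.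
  - by move=> s s' t t' _ ss' _ tt'; rewrite !big_cat /= opprD addrACA Ja.
  - by move=> s t; rewrite !big_cat /= [X in _ - X]addrC subrr.
  - move=> n; rewrite big_seq1 big_nil subr0 mulrC; apply: JM.
    rewrite -[pair_coef _]subr0; apply: (coefJ _ 0 0).
    by rewrite raddf0 !mul0r addr0.
  - move=> m m' n; rewrite !big_cons !big_nil /= !addr0.
    rewrite -mulrDl -mulrBl -rmorphD -rmorphB.
    rewrite mulrC; apply: JM.
    have [v mE] := pair_coefP m; have [v' mE'] := pair_coefP m'.
    apply: (coefJ _ _ (v + v')); rewrite raddfD /= mE mE'; ring.
  - by move=> m n n'; rewrite !big_cons !big_nil /= !addr0 -mulrDr subrr.
  - move=> a m n; rewrite !big_seq1 /=.
    rewrite (_ : _ - _ = n * overring_in B (pair_coef (a *: m) - a * pair_coef m)).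
      apply: JM; have [v mE] := pair_coefP m.
      apply: (coefJ _ _ (a * v)); rewrite linearZ /= mE /GRing.scale /=; ring.
    rewrite rmorphB rmorphM /= {2}/GRing.scale /= /overring_scale; ring.
(* Both sides become [1 ⊗ b] in [A ⊗ B], since [c x = b]. *)
have cx_b1 : tensor_eq [:: (pair_r b c, x)] [:: (pair_l b c, 1)].
  apply: (flB _ _ (@pair_val A b c : {linear _ -> _}) val_inj).
  rewrite /tensor_map /= /pair_val /=.
  have cE : (c : A^o) = c *: 1 by rewrite /GRing.scale /= mulr1.
  have bE : (b : A^o) = b *: 1 by rewrite /GRing.scale /= mulr1.
  rewrite [X in (X, x)]cE [X in (X, 1)]bE.
  apply: (tensor_trans (tensor_Z c 1 x)); apply: tensor_sym.
  rewrite (_ : c *: x = b *: (1 : B)); first exact: tensor_Z.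
  by apply: val_inj; rewrite /= xbc mulr1 mulrC divfK.
move: J1; have := phiJ _ _ cx_b1; rewrite /phi !big_seq1 /= mulr1 => cb.
have cJ : overring_in B (pair_coef (pair_r b c)) \in J.
  by rewrite -[pair_coef _]subr0; apply: (coefJ _ 0 1); rewrite mul0r add0r mul1r.
have bJ : overring_in B (pair_coef (pair_l b c)) - 1 \in J.
  rewrite -(rmorph1 (overring_in B)) -rmorphB; apply: (coefJ _ 1 0).
  by rewrite mul0r addr0 mul1r.
(* Here [v] and [u - 1] lie in [J], as 0 is a first coefficient of [c] and 1 is one of [b]. So does
   [v x - u], and these three generate 1. *)
move: cJ bJ cb; move: (overring_in B _) (overring_in B _) => u v vJ uJ vxuJ.
have E : (1 : B) = - (v * x - u) + (- (u - 1) + x * v) by ring.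
apply/negP; rewrite negbK E; apply: (Ja); first exact: JN.
by apply: Ja; [exact: JN|exact: JM].
Qed.

End FlatOverring.

Lemma prime_idealr_of (R : nzRingType) (S : {pred R}) :
  idealr_closed S -> prime_idealr_closed S -> exists Q : prime_idealr R, Q =i S.
Proof.
move=> idS prS.
pose Q : prime_idealr R :=
  HB.pack S (isIdealr.Build R S idS) (isPrimeIdealrClosed.Build R S prS).
by exists Q.
Qed.

(** * Field identities for the going down argument *)

Section FieldIdentities.
Variable F : fieldType.
Implicit Types a r s t u v x y : F.

Lemma divide_sum_l a x y r : x != 0 -> x * ((a + y / x) * r) = (a * x + y) * r.
Proof. by move=> x0; field. Qed.

Lemma divide_sum_r a x y r : x != 0 -> y != 0 ->
  y * ((a * (y / x)^-1 + 1) * r) = (a * x + y) * r.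
Proof. by move=> x0 y0; field; rewrite y0 x0. Qed.

Lemma divide_square a x : x != 0 -> a / x = a / (x * x) * x.
Proof. by move=> x0; field. Qed.

Lemma cross_divide a s t u v : s != 0 -> t != 0 -> v != 0 ->
  a / t * (u / v) = s -> v = u * (a / (s * t)).
Proof.
move=> s0 t0 v0 E; have {}E : a * u = s * (t * v) by rewrite -E; field; rewrite v0 t0.
by rewrite mulrA [u * a]mulrC E; field; rewrite t0 s0.
Qed.

End FieldIdentities.

Definition overring_elt (A : idomainType) (B : overring A) (x : {fraction A})
  (xB : x \in overring_pred B) : B := Sub x xB.

(** * Going down for valuation overrings *)

Section GoingDown.
Variables (A : idomainType) (B : overring A).
Local Notation K := {fraction A}.
Local Notation "x %:F" := (@FracField.tofrac A x).

Lemma loc_overP (Q : prime_idealr B) (x : K) :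
  reflect (exists u v : B, v \notin Q /\ x = val u / val v)
    (x \in overring_pred (loc_over Q)).
Proof. exact: asboolP. Qed.

Lemma loc_over_sub (Q : prime_idealr B) (x : K) :
  x \in overring_pred B -> x \in overring_pred (loc_over Q).
Proof.
move=> xB; apply/loc_overP; exists (overring_elt xB), 1.
by rewrite idealr1 rmorph1 divr1.
Qed.

Hypothesis valB : valuation_domain B.

(* A prime [p] of [A] below [Q] is the contraction of the largest prime of
   [B_Q] disjoint from [A \ p], namely the set of elements of [B_Q] dividing no
   element of [A \ p]. *)
Lemma valuation_going_down :
  (forall (Q : prime_idealr B) (p : prime_idealr A),
    {subset p <= contract (overring_in B) Q} ->
    forall a s, a \in p -> s \notin p -> a%:F / s%:F \in overring_pred B) ->
  going_down B.
Proof.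
move=> divB Q N; pose q := contract (overring_in B) Q.
pose D := loc_over Q; pose p := contract (overring_in (loc_dom q)) N.
(* An element of [p] outside [q] would be a unit of [A_q] lying in [N]. *)
have pq : {subset p <= q}.
  move=> a ap; apply: contraT => aq.
  have aV : 1%:F / a%:F \in overring_pred (loc_dom q).
    by apply/loc_domP; exists 1, a.
  pose ai : loc_dom q := overring_elt aV.
  suff : (1 : loc_dom q) \in N by rewrite idealr1.
  rewrite (_ : 1 = ai * overring_in (loc_dom q) a); first exact: idealMr.
  apply: val_inj; rewrite /= tofrac1 mul1r mulVf ?tofrac_eq0 //.
  exact: notin_prime_neq0 aq.
pose dvd (x : K) := exists s r, [/\ s \notin p, r \in overring_pred D & x * r = s%:F].
pose S : {pred D} := fun x => ~~ `[< dvd (val x) >].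
have SP x : reflect (~ dvd (val x)) (x \in S) by exact: asboolPn.
have BD x : x \in overring_pred B -> x \in overring_pred D by exact: loc_over_sub.
have idS : idealr_closed S.
  split.
  - apply/SP=> -[s [r [sp _ /eqP]]]; rewrite mul0r eq_sym tofrac_eq0.
    by rewrite (negPf (notin_prime_neq0 sp)).
  - apply/negP => /SP; apply; exists 1, 1.
    by rewrite idealr1 rpred1 mulr1 tofrac1.
  - move=> a x y /SP Sx /SP Sy; apply/SP => -[s [r [sp rD E]]].
    have {}E : (val a * val x + val y) * r = s%:F by exact: E.
    have [y0|y0] := eqVneq (val y) 0.
      apply: Sx; exists s, (val a * r); split=> //; first by rewrite rpredM ?(valP a).
      by rewrite -E y0 addr0; ring.
    have [x0|x0] := eqVneq (val x) 0.
      by apply: Sy; exists s, r; rewrite -E x0 mulr0 add0r.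
    (* One of [x], [y] divides the other in [B], hence divides [a x + y], and therefore [s]. *)
    have [|] := valB (val y / val x) => /BD tD.
      apply: Sx; exists s, ((val a + val y / val x) * r); split=> //.
        by rewrite rpredM // rpredD // (valP a).
      by rewrite -E divide_sum_l.
    apply: Sy; exists s, ((val a * (val y / val x)^-1 + 1) * r); split=> //.
      by rewrite rpredM // rpredD ?rpred1 // rpredM ?(valP a).
    by rewrite -E divide_sum_r.
have prS : prime_idealr_closed S.
  move=> x y /SP Sxy; apply/orP.
  have [|nx] := boolP (x \in S); first by left.
  have [|ny] := boolP (y \in S); first by right.
  have [s [r [sp rD Ex]]] := contrapT (contraNnot (introT (SP x)) nx).
  have [t [r' [tp rD' Ey]]] := contrapT (contraNnot (introT (SP y)) ny).
  case: Sxy; exists (s * t), (r * r'); split; last 1 first.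
  - by rewrite tofracM -Ex -Ey /=; ring.
  - by rewrite prime_idealrM negb_or sp.
  - by rewrite rpredM.
have [Q' QS] := prime_idealr_of idS prS; exists Q' => x.
have [a [t [tq xE]]] : exists a t, t \notin q /\ val x = a%:F / t%:F.
  exact/loc_domP/(valP x).
have tp : t \notin p by apply: contraNN tq => /pq.
have t0 : t%:F != 0 by rewrite tofrac_eq0 (notin_prime_neq0 tq).
have -> : (x \in N) = (a \in p).
  have xtE : x * overring_in (loc_dom q) t = overring_in (loc_dom q) a.
    by apply: val_inj; rewrite /= xE divfK.
  rewrite -[RHS]/(overring_in (loc_dom q) a \in N) -xtE prime_idealrM.
  by rewrite -[X in _ || X]/(t \in p) (negPf tp) orbF.
rewrite in_contract QS; apply/SP/idP => [Sx|ap [s [r [sp rD]]]].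
  apply: contraT => ap; case: Sx; exists a, t%:F; split=> //.
    exact/BD/(overring_base B).
  by rewrite /= xE divfK.
rewrite /= xE; have /loc_overP[u [v [vQ ->]]] := rD => E.
have v0 : val v != 0.
  by apply: contraNneq vQ => v0; rewrite (_ : v = 0) ?idealr0 //; apply: val_inj.
(* Clearing denominators in [x r = s] gives [v = u (a / m)]. As [v] is outside [Q], a contradiction
   follows once [a / m] is in [Q]. *)
pose m := s * t.
have mp : m \notin p by rewrite prime_idealrM negb_or sp.
have m0 : m%:F != 0 by rewrite tofrac_eq0 (notin_prime_neq0 mp).
have m2p : m * m \notin p by rewrite prime_idealrM negb_or mp.
pose y : B := overring_elt (divB Q p pq a m ap mp).
(* If [m] is in [Q], so is [a / m = (a / m^2) m]; otherwise [m (a / m) = a] in [Q] forces [a / m]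
   into the prime [Q]. *)
pose z : B := overring_elt (divB Q p pq a (m * m) ap m2p).
case/negP: vQ; rewrite (_ : v = u * y); last first.
  apply: val_inj; rewrite /= /m tofracM; apply: cross_divide E => //.
  by rewrite tofrac_eq0 (notin_prime_neq0 sp).
apply: idealMr.
have [mQ|mQ] := boolP (overring_in B m \in Q).
  rewrite (_ : y = z * overring_in B m) ?idealMr //.
  by apply: val_inj; rewrite /= (tofracM m m) -divide_square.
have : overring_in B m * y \in Q.
  rewrite (_ : _ * y = overring_in B a); first exact: (pq a ap).
  by apply: val_inj; rewrite /= mulrC divfK.
by rewrite prime_idealrM (negPf mQ).
Qed.
End GoingDown.

(** * Equality of [A_P] with its valuation overring *)

Theorem proposition8 (A : idomainType) :
  treed A -> perinormal A -> prufer A.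
Proof.
move=> trA perA P x.
have [V [J [VJ PV pJ valV]]] := treed_valuation P trA.
have Vsub : subring_closed (fun x => `[< V x >] : bool).
  split=> [|y z /asboolP Vy /asboolP Vz|y z /asboolP Vy /asboolP Vz].
  - exact/asboolP/(subring1 VJ).
  - exact/asboolP/(subringB VJ).
  - exact/asboolP/(subringM VJ).
have Vbase (a : A) : FracField.tofrac a \in (fun x => `[< V x >]).
  exact/asboolP/PV/overring_base.
pose B := Overring Vsub Vbase.
have BP (y : {fraction A}) : reflect (V y) (y \in overring_pred B) by exact: asboolP.
have valB : valuation_domain B by move=> y; case: (valV y) => /BP; [left|right].
have gdB : going_down B.
  apply: (valuation_going_down valB) => Q p pQ a s ap sp.
  apply/BP/(ideal_sub VJ)/(pJ p); last by exists a, s.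
  (* Elements of [A] outside [P] are units of [A_P], hence of [B], and cannot lie in [Q]; so
     [p <= P]. *)
  move=> b bp; apply: contraT => bP.
  have bB : 1 / FracField.tofrac b \in overring_pred B.
    by apply/BP/PV/loc_domP; exists 1, b; rewrite tofrac1.
  suff : (1 : B) \in Q by rewrite idealr1.
  rewrite (_ : 1 = overring_elt bB * overring_in B b); first exact/idealMr/(pQ b).
  by apply: val_inj; rewrite /= divfK // tofrac_eq0 (notin_prime_neq0 bP).
pose JB : {pred B} := fun y => `[< J (val y) >].
have JBP (y : B) : reflect (J (val y)) (y \in JB) by exact: asboolP.
have idJB : idealr_closed JB.
  split=> [||a y z /JBP Jy /JBP Jz].
  - exact/JBP/(ideal0 VJ).
  - by apply/JBP; exact: (ideal1 VJ).
  - by apply/JBP/(idealD VJ) => //; apply/(idealM VJ) => //; apply/BP/(valP a).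
have BsubP (y : {fraction A}) :
    y \in overring_pred B -> y \in overring_pred (loc_dom P).
  move=> yB.
  have [a [d [dJ dya]]] :=
    flat_overring_denominator idJB (overring_elt yB) (perA B gdB).
  (* [J] contains [PA_P], so an element of [A] outside [J] is outside [P]. *)
  have dP : d \notin P.
    apply: contraNN dJ => dP; apply/JBP/(pJ P) => //.
    by exists d, 1; rewrite idealr1 tofrac1 divr1.
  apply/loc_domP; exists a, d; split=> //.
  apply: (canRL (mulfK _)); first by rewrite tofrac_eq0 (notin_prime_neq0 dP).
  by rewrite mulrC; have := congr1 val dya.
by case: (valB x) => /BsubP; [left|right].
Qed.
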